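(* Let $G=(V,E,w)$ be a weighted simple undirected graph with $|V|=n$, Laplacian $\boldsymbol{L}$ and total weight $W=\sum_{e\in E}w_e$. Let $\epsilon>0$, $\delta\in(0,1]$, and let $r$ be a positive integer with $r\geqslant\frac{1}{\delta^2\epsilon^2}$. Let $\tilde{\boldsymbol{L}}$ be the random Laplacian output by the $CR$ spectral sparsifier algorithm on input $(G,r)$, that is, with $r$ independent sampling trials under the sampling probabilities $p_e=w_e/W$, and let $\tilde{G}$ be the corresponding sketched graph. Then: (i) with probability at least $1-\delta$, $\tilde{G}$ is an additive $\varepsilon$-spectral sparsifier of $G$ with $\varepsilon=2W\epsilon$, i.e. $$\Pr\Big[\ \big|\boldsymbol{x}^T(\boldsymbol{L}-\tilde{\boldsymbol{L}})\boldsymbol{x}\big|\leqslant 2W\epsilon\cdot\|\boldsymbol{x}\|_2^2\ \text{ for all }\boldsymbol{x}\in\mathbb{R}^n\ \Big]\geqslant 1-\delta ;$$ (ii) the sparsifier is of minimum variance: among all probability distributions $q=(q_e)_{e\in E}$ on $E$ with $q_e>0$ for every $e\in E$, the choice $q_e=p_e=w_e/W$ minimizes $\mathbb{E}\big[\|\boldsymbol{L}-\tilde{\boldsymbol{L}}_q\|_F^2\big]$, where $\tilde{\boldsymbol{L}}_q$ is the estimator obtained by sampling edges according to $q$ with the corresponding rescaling (so that $\tilde{\boldsymbol{L}}=\tilde{\boldsymbol{L}}_p$).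
   Context: $G=(V,E,w)$ is a finite weighted simple undirected graph with $|V|=n$, nonempty edge set $E$, and weights $w_e>0$ for $e\in E$. Fix an arbitrary orientation of each edge. For $e=(u,v)\in E$ let $\chi_e=\boldsymbol{e}_u-\boldsymbol{e}_v\in\mathbb{R}^V$ be the incidence vector ($\boldsymbol{e}_i$ the standard basis vectors) and $\tilde{\chi}_e=\sqrt{w_e}\,\chi_e$ the weighted incidence vector. The Laplacian of $G$ is $\boldsymbol{L}=\sum_{e\in E}w_e\,\chi_e\chi_e^T=\boldsymbol{B}^T\boldsymbol{B}\in\mathbb{R}^{V\times V}$, where the boundary matrix $\boldsymbol{B}\in\mathbb{R}^{E\times V}$ is the matrix with rows $\tilde{\chi}_e^T$ (up to sign). $CR$ spectral sparsifier algorithm. Input: $G=(V,E,w)$ and the number $r$ of sampling trials. Put $W=\sum_{e\in E}w_e$ and $p_e=w_e/W$. Start with $\tilde{\boldsymbol{L}}=\boldsymbol{0}$; for $i=1,\dots,r$, sample an edge $e'\in E$ independently, with replacement, according to $\{p_e\}_{e\in E}$, and update $\tilde{\boldsymbol{L}}\gets\tilde{\boldsymbol{L}}+\frac{1}{rp_{e'}}\tilde{\chi}_{e'}\tilde{\chi}_{e'}^T=\tilde{\boldsymbol{L}}+\frac{W}{r}\chi_{e'}\chi_{e'}^T$. Output: $\tilde{\boldsymbol{L}}$, which is the Laplacian of the sketched graph $\tilde{G}=(V,\tilde{E},\tilde{w})$ whose edges are the sampled edges, each receiving weight $\frac{W}{r}$ times the number of times it was sampled. For a general distribution $q$ on $E$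 with all $q_e>0$, $\tilde{\boldsymbol{L}}_q=\sum_{i=1}^r\frac{1}{rq_{e_i}}\tilde{\chi}_{e_i}\tilde{\chi}_{e_i}^T$, where $e_1,\dots,e_r$ are drawn i.i.d. from $q$. Additive $\varepsilon$-spectral sparsifier: a graph $\tilde{G}$ on $V$ with Laplacian $\tilde{\boldsymbol{L}}$ is an additive $\varepsilon$-spectral sparsifier of $G$ if $\boldsymbol{x}^T(\tilde{\boldsymbol{L}}-\varepsilon\boldsymbol{I}_n)\boldsymbol{x}\leqslant\boldsymbol{x}^T\boldsymbol{L}\boldsymbol{x}\leqslant\boldsymbol{x}^T(\tilde{\boldsymbol{L}}+\varepsilon\boldsymbol{I}_n)\boldsymbol{x}$ for all $\boldsymbol{x}\in\mathbb{R}^n$, equivalently $|\boldsymbol{x}^T(\boldsymbol{L}-\tilde{\boldsymbol{L}})\boldsymbol{x}|\leqslant\varepsilon\|\boldsymbol{x}\|_2^2$ for all $\boldsymbol{x}\in\mathbb{R}^n$. $\|\cdot\|_F$ is the Frobenius norm. *)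

(* Defs.v *)
From mathcomp Require Import all_boot all_order all_algebra.
From mathcomp Require Import boolp reals.

Set Implicit Arguments.
Unset Strict Implicit.
Unset Printing Implicit Defensive.
Import Order.TTheory GRing.Theory Num.Theory.
Local Open Scope ring_scope.

(* Weighted simple undirected graphs on the vertex set 'I_n: an edge is a
   two-element set of vertices.  The values of [weight] outside [edges] are
   irrelevant: no definition below reads them. *)
Record wgraph (R : realType) (n : nat) := WGraph {
  edges : {set {set 'I_n}};
  weight : {set 'I_n} -> R;
  edges_card2 : forall e, e \in edges -> #|e| = 2%N;
  weight_gt0 : forall e, e \in edges -> 0 < weight e }.

Definition edge (R : realType) (n : nat) (G : wgraph R n) : finType :=
  {e : {set 'I_n} | e \in edges G}.

Definition total_weight (R : realType) (n : nat) (G : wgraph R n) : R :=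
  \sum_(e in edges G) weight G e.

(* [o e] is the ordered pair of endpoints of [e].  An orientation of a graph
   also orients all its subgraphs, such as the sketched graph below. *)
Definition orients (R : realType) (n : nat)
    (o : {set 'I_n} -> 'I_n * 'I_n) (G : wgraph R n) : Prop :=
  forall e, e \in edges G -> e = [set (o e).1; (o e).2].

Definition incidence (R : realType) (n : nat)
    (o : {set 'I_n} -> 'I_n * 'I_n) (e : {set 'I_n}) : 'cV[R]_n :=
  delta_mx (o e).1 0 - delta_mx (o e).2 0.

Definition wincidence (R : realType) (n : nat) (G : wgraph R n)
    (o : {set 'I_n} -> 'I_n * 'I_n) (e : {set 'I_n}) : 'cV[R]_n :=
  Num.sqrt (weight G e) *: incidence R o e.

Definition laplacian (R : realType) (n : nat) (G : wgraph R n)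
    (o : {set 'I_n} -> 'I_n * 'I_n) : 'M[R]_n :=
  \sum_(e in edges G) weight G e *: (incidence R o e *m (incidence R o e)^T).

Definition qform (R : realType) (n : nat) (M : 'M[R]_n) (x : 'cV[R]_n) : R :=
  (x^T *m M *m x) 0 0.

Definition norm2 (R : realType) (n : nat) (x : 'cV[R]_n) : R :=
  Num.sqrt (\sum_i x i 0 ^+ 2).

Definition frobenius (R : realType) (m n : nat) (A : 'M[R]_(m, n)) : R :=
  Num.sqrt (\sum_i \sum_j A i j ^+ 2).

Definition additive_sparsifier (R : realType) (n : nat) (eps : R)
    (o : {set 'I_n} -> 'I_n * 'I_n) (H G : wgraph R n) : Prop :=
  forall x : 'cV[R]_n,
    qform (laplacian H o - eps%:M) x <= qform (laplacian G o) x /\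
    qform (laplacian G o) x <= qform (laplacian H o + eps%:M) x.

Definition pos_distribution (R : realType) (n : nat) (G : wgraph R n)
    (q : edge G -> R) : Prop :=
  (forall e, 0 < q e) /\ \sum_e q e = 1.

(* The outcomes of r independent draws with replacement, with product law
   s |-> \prod_i q (s i). *)
Definition sample (R : realType) (n : nat) (G : wgraph R n) (r : nat)
    : finType := {ffun 'I_r -> edge G}.

Definition Pr (R : realType) (n : nat) (G : wgraph R n) (r : nat)
    (q : edge G -> R) (A : sample G r -> Prop) : R :=
  \sum_(s : sample G r | `[< A s >]) \prod_(i < r) q (s i).

Definition Expect (R : realType) (n : nat) (G : wgraph R n) (r : nat)
    (q : edge G -> R) (f : sample G r -> R) : R :=
  \sum_(s : sample G r) (\prod_(i < r) q (s i)) * f s.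

Definition estimator (R : realType) (n : nat) (G : wgraph R n) (r : nat)
    (o : {set 'I_n} -> 'I_n * 'I_n) (q : edge G -> R) (s : sample G r)
    : 'M[R]_n :=
  \sum_(i < r) (r%:R * q (s i))^-1 *:
    (wincidence G o (val (s i)) *m (wincidence G o (val (s i)))^T).

Definition cr_prob (R : realType) (n : nat) (G : wgraph R n) (e : edge G) : R :=
  weight G (val e) / total_weight G.

Definition cr_laplacian (R : realType) (n : nat) (G : wgraph R n) (r : nat)
    (o : {set 'I_n} -> 'I_n * 'I_n) (s : sample G r) : 'M[R]_n :=
  estimator o (@cr_prob R n G) s.

Definition sketch_edges (R : realType) (n : nat) (G : wgraph R n) (r : nat)
    (s : sample G r) : {set {set 'I_n}} := [set val (s i) | i : 'I_r].

Definition sketch_weight (R : realType) (n : nat) (G : wgraph R n) (r : nat)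
    (s : sample G r) (e : {set 'I_n}) : R :=
  total_weight G / r%:R * #|[set i : 'I_r | val (s i) == e]|%:R.

Lemma sketch_edges_card2 (R : realType) (n : nat) (G : wgraph R n) (r : nat)
    (s : sample G r) (e : {set 'I_n}) : e \in sketch_edges s -> #|e| = 2%N.
Proof. by case/imsetP => i _ ->; apply: edges_card2 (valP (s i)). Qed.

Lemma total_weight_gt0 (R : realType) (n : nat) (G : wgraph R n)
    (e : edge G) : 0 < total_weight G.
Proof.
rewrite /total_weight (bigD1 (val e)) ?(valP e) //=.
apply: ltr_pwDl; first exact: weight_gt0 (valP e).
by apply: sumr_ge0 => f /andP[fG _]; apply/ltW/weight_gt0.
Qed.

Lemma sketch_weight_gt0 (R : realType) (n : nat) (G : wgraph R n) (r : nat)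
    (s : sample G r) (e : {set 'I_n}) :
  e \in sketch_edges s -> 0 < sketch_weight s e.
Proof.
case/imsetP => i _ ->; apply: mulr_gt0.
  apply: divr_gt0; first exact: total_weight_gt0 (s i).
  by rewrite ltr0n; apply: leq_ltn_trans (ltn_ord i).
by rewrite ltr0n; apply/card_gt0P; exists i; rewrite inE.
Qed.

Definition sketch (R : realType) (n : nat) (G : wgraph R n) (r : nat)
    (s : sample G r) : wgraph R n :=
  WGraph (@sketch_edges_card2 R n G r s) (@sketch_weight_gt0 R n G r s).

Lemma laplacian_sketch (R : realType) (n : nat) (G : wgraph R n) (r : nat)
    (o : {set 'I_n} -> 'I_n * 'I_n) (s : sample G r) :
  laplacian (sketch s) o = cr_laplacian o s.
Proof.
rewrite /cr_laplacian /estimator /laplacian /=.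
rewrite (partition_big (fun i => val (s i)) (mem (sketch_edges s))) /=; last first.
  by move=> i _; apply/imsetP; exists i.
apply: eq_bigr => e _; rewrite /sketch_weight.
rewrite (eq_bigr (fun=> (total_weight G / r%:R) *:
    (incidence R o e *m (incidence R o e)^T))); last first.
  move=> i /eqP <-; rewrite /wincidence linearZ /= -scalemxAl -scalemxAr !scalerA.
  have w0 := weight_gt0 (valP (s i)).
  rewrite -mulrA -expr2 sqr_sqrtr ?ltW // /cr_prob; congr (_ *: _).
  rewrite !invfM invrK -!mulrA [_ * weight _ _]mulrC mulKf ?gt_eqF //.
  by rewrite mulrC.
by rewrite sumr_const -scaler_nat scalerA mulrC cardsE.
Qed.

(* Main.v *)
(* Since |x^T M x| <= ||M||_F ||x||^2, the tail bound only needs the second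
   moment of the Frobenius error.  Entry by entry, L - L~_q is a sum of r i.i.d.
   centred variables and each chi_e chi_e^T has squared Frobenius norm 4, so
     E ||L - L~_q||_F^2 = (4 sum_e w_e^2 / q_e - ||L||_F^2) / r.
   Expanding sum_e q_e (w_e / q_e - W)^2 >= 0 gives sum_e w_e^2 / q_e >= W^2,
   with equality at q = p.  For q = p the error is thus at most 4 W^2 / r, and
   Chebyshev bounds the failure probability by 1 / (r eps^2) <= delta^2 <= delta. *)

Require Import Defs.
From mathcomp Require Import all_boot all_order all_algebra.
From mathcomp Require Import boolp reals.
From mathcomp Require Import ring lra.

Set Implicit Arguments.
Unset Strict Implicit.
Unset Printing Implicit Defensive.
Import Order.TTheory GRing.Theory Num.Theory.
Local Open Scope ring_scope.

(** * Cauchy-Schwarz for finite sums and the product law of independent draws *)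

Lemma cauchy_schwarz_sum (R : realFieldType) (I : finType) (a b : I -> R) :
  (\sum_i a i * b i) ^+ 2 <= (\sum_i a i ^+ 2) * (\sum_i b i ^+ 2).
Proof.
have sum0 : 0 <= \sum_i \sum_j (a i * b j - a j * b i) ^+ 2.
  by apply: sumr_ge0 => i _; apply: sumr_ge0 => j _; apply: sqr_ge0.
(* Lagrange's identity; summing over ordered pairs counts each pair twice, hence the factor 2. *)
suff lagrange : \sum_i \sum_j (a i * b j - a j * b i) ^+ 2 =
    2 * ((\sum_i a i ^+ 2) * (\sum_i b i ^+ 2) - (\sum_i a i * b i) ^+ 2).
  by move: sum0; rewrite lagrange pmulr_rge0 // subr_ge0.
have sumE (f g : I -> R) :
    (\sum_i f i) * (\sum_j g j) = \sum_i \sum_j f i * g j.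
  by rewrite big_distrlr.
rewrite mulrBr mulr_natl mulr2n {2}[_ * \sum_i b i ^+ 2]mulrC expr2 !sumE.
rewrite mulr_sumr -big_split -sumrB; apply: eq_bigr => i _ /=.
rewrite mulr_sumr -big_split -sumrB; apply: eq_bigr => j _ /=.
ring.
Qed.

(** Independence of the draws, in the form of distributivity of product over sum. *)
Lemma sum_ffun_prod (R : comNzRingType) (T : finType) (r : nat) (q : T -> R)
    (h : 'I_r -> T -> R) :
  \sum_(s : {ffun 'I_r -> T}) (\prod_i q (s i)) * (\prod_i h i (s i)) =
  \prod_i \sum_e q e * h i e.
Proof.
by rewrite bigA_distr_bigA; apply: eq_bigr => s _; rewrite -big_split.
Qed.

Lemma sum_ffun_prod1 (R : comNzRingType) (T : finType) (r : nat) (q : T -> R) :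
  \sum_e q e = 1 -> \sum_(s : {ffun 'I_r -> T}) \prod_i q (s i) = 1.
Proof. by move=> q1; rewrite -(bigA_distr_bigA (fun=> q)) big1. Qed.

(* The cross terms vanish by independence. *)
Lemma sum_ffun_variance (R : comNzRingType) (T : finType) (r : nat)
    (q z : T -> R) :
  \sum_e q e = 1 -> \sum_e q e * z e = 0 ->
  \sum_(s : {ffun 'I_r -> T}) (\prod_i q (s i)) * (\sum_i z (s i)) ^+ 2 =
  r%:R * \sum_e q e * z e ^+ 2.
Proof.
move=> q1 z0.
have cross (i j : 'I_r) :
    \sum_(s : {ffun 'I_r -> T}) (\prod_k q (s k)) * (z (s i) * z (s j)) =
    if j == i then \sum_e q e * z e ^+ 2 else 0.
  (* The factor is 1 at every draw other than [i] and [j], so the product factorises over draws; for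
     [i = j] the two factors merge into [z e ^+ 2]. *)
  pose h k e := (if k == i then z e else 1) * (if k == j then z e else 1).
  under eq_bigr => s _.
    have -> : z (s i) * z (s j) = \prod_k h k (s k).
      by rewrite big_split /= -!big_mkcond !big_pred1_eq.
    over.
  rewrite sum_ffun_prod (bigD1 i) //= /h eqxx.
  have [->|ij] := eqVneq j i.
    rewrite [X in _ * X]big1 ?mulr1 => [|k /negPf ->].
      by apply: eq_bigr => e _; rewrite expr2.
    by rewrite -[RHS]q1; apply: eq_bigr => e _; rewrite !mulr1.
  (* For [j] different from [i], the factor at draw [i] is the mean of [z], which is 0. *)
  rewrite (eq_bigr (fun e => q e * z e)) ?z0 ?mul0r // => e _.
  by rewrite mulr1.
under eq_bigr => s _ do rewrite expr2 big_distrlr mulr_sumr.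
rewrite exchange_big /= -[in RHS](card_ord r) mulr_natl -sumr_const.
apply: eq_bigr => i _.
under eq_bigr => s _ do rewrite mulr_sumr.
rewrite exchange_big /= (eq_bigr _ (fun j _ => cross i j)).
by rewrite -big_mkcond big_pred1_eq.
Qed.

(** * Norms and quadratic forms *)

Lemma sqr_norm2 (R : realType) (n : nat) (x : 'cV[R]_n) :
  norm2 x ^+ 2 = \sum_i x i 0 ^+ 2.
Proof. by rewrite sqr_sqrtr // sumr_ge0 // => i _; apply: sqr_ge0. Qed.

Lemma sqr_frobenius (R : realType) (m n : nat) (A : 'M[R]_(m, n)) :
  frobenius A ^+ 2 = \sum_i \sum_j A i j ^+ 2.
Proof.
rewrite sqr_sqrtr // sumr_ge0 // => i _; rewrite sumr_ge0 // => j _.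
exact: sqr_ge0.
Qed.

Lemma qformE (R : realType) (n : nat) (M : 'M[R]_n) (x : 'cV[R]_n) :
  qform M x = \sum_i \sum_j M i j * (x i 0 * x j 0).
Proof.
rewrite /qform mxE exchange_big /=; apply: eq_bigr => j _.
by rewrite mxE mulr_suml; apply: eq_bigr => i _; rewrite mxE; ring.
Qed.

Lemma qformD (R : realType) (n : nat) (A B : 'M[R]_n) (x : 'cV[R]_n) :
  qform (A + B) x = qform A x + qform B x.
Proof. by rewrite /qform mulmxDr mulmxDl mxE. Qed.

Lemma qformB (R : realType) (n : nat) (A B : 'M[R]_n) (x : 'cV[R]_n) :
  qform (A - B) x = qform A x - qform B x.
Proof. by rewrite /qform mulmxBr mulmxBl !mxE. Qed.

Lemma qform_scalar (R : realType) (n : nat) (a : R) (x : 'cV[R]_n) :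
  qform a%:M x = a * norm2 x ^+ 2.
Proof.
rewrite sqr_norm2 /qform mul_mx_scalar -scalemxAl mxE; congr (_ * _).
by rewrite mxE; apply: eq_bigr => i _; rewrite mxE expr2.
Qed.

(** Cauchy-Schwarz over index pairs, applied to the entries [M i j] and the products
    [x i 0 * x j 0]; the squares of the latter sum to [norm2 x ^+ 4]. *)
Lemma qform_le_frobenius (R : realType) (n : nat) (M : 'M[R]_n) (x : 'cV[R]_n) :
  `|qform M x| <= frobenius M * norm2 x ^+ 2.
Proof.
rewrite -ler_sqr ?nnegrE ?mulr_ge0 ?sqrtr_ge0 ?sqr_ge0 // real_normK ?num_real //.
rewrite exprMn sqr_frobenius qformE expr2 sqr_norm2 !pair_bigA /=.
have := cauchy_schwarz_sum (fun p : 'I_n * 'I_n => M p.1 p.2)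
                           (fun p => x p.1 0 * x p.2 0).
move=> /le_trans; apply; rewrite ler_wpM2l //.
  by apply: sumr_ge0 => p _; apply: sqr_ge0.
rewrite expr2 big_distrlr /= pair_bigA /=.
by apply: ler_sum => p _; rewrite exprMn.
Qed.

Lemma qform_additive_sparsifier (R : realType) (n : nat) (eps : R)
    (o : {set 'I_n} -> 'I_n * 'I_n) (H G : wgraph R n) :
  (forall x : 'cV[R]_n,
    `|qform (laplacian G o - laplacian H o) x| <= eps * norm2 x ^+ 2) ->
  additive_sparsifier eps o H G.
Proof.
move=> le_eps x; have := le_eps x.
rewrite !qformB qformD qform_scalar ler_norml => /andP[lo hi].
by split; lra.
Qed.

(** * Outer products of incidence vectors *)

Lemma sum_sqr_outer (R : realType) (n : nat) (v : 'cV[R]_n) :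
  \sum_i \sum_j (v i 0 * v j 0) ^+ 2 = (\sum_i v i 0 ^+ 2) ^+ 2.
Proof.
rewrite [RHS]expr2 big_distrlr /=; apply: eq_bigr => i _.
by apply: eq_bigr => j _; rewrite exprMn.
Qed.

Lemma sum_sqr_incidence (R : realType) (n : nat)
    (o : {set 'I_n} -> 'I_n * 'I_n) (G : wgraph R n) (e : {set 'I_n}) :
  orients o G -> e \in edges G -> \sum_i incidence R o e i 0 ^+ 2 = 2.
Proof.
(* An edge has two elements, so its endpoints differ and the entries 1 and -1 do not cancel. *)
move=> ho eG; have := edges_card2 eG; rewrite {1}(ho _ eG) cards2.
rewrite /incidence; case: (o e) => a b /=; case: (boolP (a == b)) => //= ab _.
rewrite (bigD1 a) //= (bigD1 b) 1?eq_sym //= big1 => [|i /andP[ia ib]].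
  by rewrite !mxE !eqxx [b == a]eq_sym (negPf ab) /=; ring.
by rewrite !mxE (negPf ia) (negPf ib) /=; ring.
Qed.

Lemma wincidence_outer (R : realType) (n : nat) (G : wgraph R n)
    (o : {set 'I_n} -> 'I_n * 'I_n) (e : edge G) (i j : 'I_n) :
  (wincidence G o (val e) *m (wincidence G o (val e))^T) i j =
  weight G (val e) * (incidence R o (val e) i 0 * incidence R o (val e) j 0).
Proof.
have w0 := ltW (weight_gt0 (valP e)).
rewrite /wincidence linearZ /= -scalemxAl -scalemxAr scalerA -expr2.
by rewrite (sqr_sqrtr w0) 2!mxE big_ord1 [_^T _ _]mxE.
Qed.

(** * Second moment of the Frobenius error *)

Section Variance.
Context (R : realType) (n : nat) (G : wgraph R n) (r : nat).
Context (o : {set 'I_n} -> 'I_n * 'I_n) (ho : orients o G) (r_gt0 : (0 < r)%N).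

Local Notation w := (fun e : edge G => weight G (val e)).
Local Notation chi := (fun (e : edge G) i => incidence R o (val e) i 0).

Lemma laplacian_entry i j :
  laplacian G o i j = \sum_e w e * (chi e i * chi e j).
Proof.
rewrite /laplacian summxE big_sub; apply: eq_bigr => e _.
by rewrite 2!mxE big_ord1 [_^T _ _]mxE.
Qed.

Lemma expect_entry (q : edge G -> R) i j : pos_distribution q ->
  Expect q (fun s : sample G r => (laplacian G o - estimator o q s) i j ^+ 2) =
  r%:R^-1 * (\sum_e w e ^+ 2 / q e * (chi e i * chi e j) ^+ 2
             - laplacian G o i j ^+ 2).
Proof.
move=> [q_gt0 q1]; have r0 : r%:R != 0 :> R by rewrite pnatr_eq0 -lt0n.
set l := laplacian G o i j.
pose y e := w e * (chi e i * chi e j).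
(* Centred contribution of one draw: the mean [l] is split evenly over the [r] draws. *)
pose z e := r%:R^-1 * (l - (q e)^-1 * y e).
have qy : \sum_e q e * ((q e)^-1 * y e) = l.
  rewrite /l laplacian_entry; apply: eq_bigr => e _.
  by rewrite mulVKf ?gt_eqF.
have z0 : \sum_e q e * z e = 0.
  under eq_bigr => e _ do rewrite mulrCA mulrBr.
  by rewrite -mulr_sumr sumrB -mulr_suml q1 qy mul1r subrr mulr0.
have entryE (s : sample G r) :
    (laplacian G o - estimator o q s) i j = \sum_k z (s k).
  rewrite 2!mxE -/l /z -mulr_sumr sumrB sumr_const card_ord -[l *+ r]mulr_natl.
  rewrite mulrBr mulKf // /estimator summxE mulr_sumr; congr (_ - _).
  by apply: eq_bigr => k _; rewrite mxE wincidence_outer invfM -mulrA.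
rewrite /Expect; under eq_bigr => s _ do rewrite entryE.
rewrite (sum_ffun_variance r q1 z0).
(* The square is expanded so that the mean of [y / q], already known to be [l], appears in the cross
   term; the first two terms then sum to [- l ^+ 2]. *)
have -> : \sum_e q e * z e ^+ 2 =
    r%:R^-1 ^+ 2 * \sum_e (q e * l ^+ 2 - 2 * l * (q e * ((q e)^-1 * y e))
                           + w e ^+ 2 / q e * (chi e i * chi e j) ^+ 2).
  rewrite mulr_sumr; apply: eq_bigr => e _; rewrite /z /y.
  by field; rewrite r0 gt_eqF.
rewrite big_split sumrB /= -mulr_suml -mulr_sumr q1 qy.
by field.
Qed.

Lemma expect_frobenius (q : edge G -> R) : pos_distribution q ->
  Expect q (fun s : sample G r => frobenius (laplacian G o - estimator o q s) ^+ 2) =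
  r%:R^-1 * (4 * (\sum_e w e ^+ 2 / q e) - frobenius (laplacian G o) ^+ 2).
Proof.
move=> hq; transitivity (\sum_i \sum_j Expect q
    (fun s : sample G r => (laplacian G o - estimator o q s) i j ^+ 2)).
  rewrite /Expect; under eq_bigr => s _ do rewrite sqr_frobenius mulr_sumr.
  rewrite exchange_big; apply: eq_bigr => i _ /=.
  by rewrite exchange_big; apply: eq_bigr => s _ /=; rewrite mulr_sumr.
under eq_bigr => i _.
  under eq_bigr => j _ do rewrite (expect_entry i j hq).
  rewrite -mulr_sumr sumrB exchange_big /=.
  over.
rewrite -mulr_sumr sumrB -sqr_frobenius exchange_big /= mulr_sumr.
congr (_ * (_ - _)); apply: eq_bigr => e _.
(* For a fixed edge the double sum is the square of [\sum_i chi e i ^+ 2 = 2], which gives the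
   constant 4. *)
under eq_bigr => i _ do rewrite -mulr_sumr.
rewrite -mulr_sumr sum_sqr_outer (sum_sqr_incidence ho (valP e)).
by rewrite mulrC; congr (_ * _); ring.
Qed.

Lemma total_weight_edge : total_weight G = \sum_e w e.
Proof. exact: big_sub. Qed.

Lemma sum_sqr_weight_ge (q : edge G -> R) : pos_distribution q ->
  total_weight G ^+ 2 <= \sum_e w e ^+ 2 / q e.
Proof.
move=> [q_gt0 q1]; set W := total_weight G.
have : 0 <= \sum_e q e * (w e / q e - W) ^+ 2.
  by apply: sumr_ge0 => e _; rewrite mulr_ge0 ?sqr_ge0 ?ltW.
have -> : \sum_e q e * (w e / q e - W) ^+ 2 =
    \sum_e (w e ^+ 2 / q e - 2 * W * w e + q e * W ^+ 2).
  by apply: eq_bigr => e _; field; rewrite gt_eqF.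
rewrite big_split sumrB /= -mulr_sumr -mulr_suml q1 -total_weight_edge -/W.
(* With W the total weight and S the sum on the right, [h] reads 0 <= S - 2 W W + W^2. *)
by move=> h; nra.
Qed.

End Variance.

(** * The distribution proportional to the weights *)

Lemma total_weight_pos (R : realType) (n : nat) (G : wgraph R n) :
  edges G != set0 -> 0 < total_weight G.
Proof. by case/set0Pn => e eG; apply: (total_weight_gt0 (Sub e eG : edge G)). Qed.

Lemma cr_prob_distribution (R : realType) (n : nat) (G : wgraph R n) :
  edges G != set0 -> pos_distribution (@cr_prob R n G).
Proof.
move=> /total_weight_pos W0; split=> [e|].
  by rewrite divr_gt0 // (weight_gt0 (valP e)).
by rewrite -mulr_suml -total_weight_edge divff ?gt_eqF.
Qed.

(** Each term collapses to [weight G (val e) * total_weight G], so the lower bound of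
    [sum_sqr_weight_ge] is attained. *)
Lemma sum_sqr_weight_cr (R : realType) (n : nat) (G : wgraph R n) :
  edges G != set0 ->
  \sum_(e : edge G) weight G (val e) ^+ 2 / cr_prob e = total_weight G ^+ 2.
Proof.
move=> /total_weight_pos W0; rewrite [RHS]expr2 {1}total_weight_edge mulr_suml.
apply: eq_bigr => e _; rewrite /cr_prob; have := weight_gt0 (valP e).
by move=> w0; field; rewrite !gt_eqF.
Qed.

Lemma Pr_mono (R : realType) (n : nat) (G : wgraph R n) (r : nat)
    (q : edge G -> R) (A B : sample G r -> Prop) :
  (forall e, 0 <= q e) -> (forall s, A s -> B s) -> Pr q A <= Pr q B.
Proof.
move=> q0 AB; rewrite /Pr [leLHS]big_mkcond [leRHS]big_mkcond.
apply: ler_sum => s _ /=.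
case: asboolP => [/AB /asboolP -> //|_]; case: ifP => // _.
exact: prodr_ge0.
Qed.

(** Outcome by outcome, the indicator of [t < f s] is at most [f s ^+ 2 / t ^+ 2]; averaging gives
    the bound, with 1 written as the total mass of the product law. *)
Lemma chebyshev_Pr (R : realType) (n : nat) (G : wgraph R n) (r : nat)
    (q : edge G -> R) (f : sample G r -> R) (t : R) :
  pos_distribution q -> 0 < t -> (forall s, 0 <= f s) ->
  1 - Expect q (fun s => f s ^+ 2) / t ^+ 2 <= Pr q (fun s => f s <= t).
Proof.
move=> [q_gt0 q1] t0 f0.
have <- : \sum_(s : sample G r) \prod_i q (s i) = 1 := sum_ffun_prod1 r q1.
rewrite lerBlDr -lerBlDl /Pr /Expect [X in _ - X]big_mkcond /=.
rewrite -sumrB mulr_suml; apply: ler_sum => s _.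
have p0 : 0 <= \prod_i q (s i) by apply: prodr_ge0 => i _; apply: ltW.
case: asboolP => [_|/negP]; first by rewrite subrr divr_ge0 ?sqr_ge0 // mulr_ge0 ?sqr_ge0.
rewrite -ltNge subr0 -mulrA => tf; rewrite ler_peMr //.
by rewrite ler_pdivlMr ?exprn_gt0 // mul1r ler_sqr ?nnegrE // ltW.
Qed.

Theorem proposition1 (R : realType) (n : nat) (G : wgraph R n)
    (hE : edges G != set0)
    (o : {set 'I_n} -> 'I_n * 'I_n) (ho : orients o G)
    (eps delta : R) (heps : 0 < eps) (hdelta0 : 0 < delta) (hdelta1 : delta <= 1)
    (r : nat) (hr0 : (0 < r)%N) (hr : 1 / (delta ^+ 2 * eps ^+ 2) <= r%:R) :
  [/\ 1 - delta <=
        Pr (@cr_prob R n G) (fun s : sample G r =>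
          additive_sparsifier (2 * total_weight G * eps) o (sketch s) G),
      1 - delta <=
        Pr (@cr_prob R n G) (fun s : sample G r =>
          forall x : 'cV[R]_n,
            `|qform (laplacian G o - cr_laplacian o s) x|
              <= 2 * total_weight G * eps * norm2 x ^+ 2)
    & pos_distribution (@cr_prob R n G) /\
      forall q : edge G -> R, pos_distribution q ->
        Expect (@cr_prob R n G) (fun s : sample G r =>
          frobenius (laplacian G o - estimator o (@cr_prob R n G) s) ^+ 2)
        <= Expect q (fun s : sample G r =>
          frobenius (laplacian G o - estimator o q s) ^+ 2)].
Proof.
have W0 := total_weight_pos hE; have hp := cr_prob_distribution hE.
have p0 e : 0 <= @cr_prob R n G e by apply/ltW/hp.1.
have t0 : 0 < 2 * total_weight G * eps by rewrite !mulr_gt0.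
have r0 : 0 < r%:R :> R by rewrite ltr0n.
(* This single event on the Frobenius error implies the events of both probability claims. *)
have tail : 1 - delta <= Pr (@cr_prob R n G) (fun s : sample G r =>
    frobenius (laplacian G o - cr_laplacian o s) <= 2 * total_weight G * eps).
  apply: le_trans (chebyshev_Pr hp t0 (fun s => sqrtr_ge0 _)).
  rewrite lerD2l lerN2 (expect_frobenius ho hr0 hp) (sum_sqr_weight_cr hE).
  rewrite ler_pdivrMr ?exprn_gt0 //.
  have de : 1 <= delta ^+ 2 * eps ^+ 2 * r%:R.
    by move: hr; rewrite ler_pdivrMr ?mulr_gt0 ?exprn_gt0 // mulrC.
  (* One factor [delta <= 1] is dropped, as Chebyshev needs only [delta] to the first power. *)
  have de' : 1 <= delta * eps ^+ 2 * r%:R.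
    by apply: (le_trans de); rewrite -!mulrA ler_piMl // !mulr_ge0 // ltW.
  rewrite ler_pdivrMl //.
  (* The term [- frobenius (laplacian G o) ^+ 2] is discarded. *)
  apply: (@le_trans _ _ (4 * total_weight G ^+ 2)).
    by rewrite gerDl oppr_le0 sqr_ge0.
  have -> : r%:R * (delta * (2 * total_weight G * eps) ^+ 2) =
      4 * total_weight G ^+ 2 * (delta * eps ^+ 2 * r%:R) by ring.
  by rewrite ler_peMr // mulr_ge0 ?sqr_ge0.
have bound (s : sample G r) :
    frobenius (laplacian G o - cr_laplacian o s) <= 2 * total_weight G * eps ->
    forall x : 'cV[R]_n, `|qform (laplacian G o - cr_laplacian o s) x|
      <= 2 * total_weight G * eps * norm2 x ^+ 2.
  move=> h x; apply: le_trans (qform_le_frobenius _ _) _.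
  by rewrite ler_wpM2r ?sqr_ge0.
split.
- apply: le_trans tail (Pr_mono p0 _) => s /bound h.
  by apply: qform_additive_sparsifier; rewrite laplacian_sketch.
- exact: le_trans tail (Pr_mono p0 bound).
split=> // q hq.
(* The two expectations differ only in the sum of squared weights over probabilities, since the norm
   of the Laplacian does not depend on [q]. *)
rewrite !(expect_frobenius ho hr0) // (sum_sqr_weight_cr hE).
rewrite ler_pM2l ?invr_gt0 // lerD2r ler_pM2l //.
exact: sum_sqr_weight_ge.
Qed.
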